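(* Let $\Delta t>0$ be the time step and $\mathrm{CFL}$ the corresponding CFL number of the Cartesian grid Active Flux method in which the evolution operator is used. Let $\omega\in[0,1]$ and let $\delta,\nu\ge 0$ satisfy $\delta\cdot\mathrm{CFL}\le 0.5$ and $\nu\cdot\mathrm{CFL}\le 0.5$. Let $(\rho,u,v,p):\mathbb{R}^2\times[0,T)\to\mathbb{R}^4$ be a $C^3$ solution of the linearized Euler equations with constant background state $(\rho',u',v',p')$ (see context). Fix $(x,y)\in\mathbb{R}^2$ and $t\in[0,T)$, and for $\tau\in(0,\Delta t]$ with $t+\tau<T$ put $P=(x,y,t+\tau)$, $P'=(x-u'\tau,\,y-v'\tau,\,t)$ and $Q(\theta)=(x-(u'-c'\cos\theta)\tau,\ y-(v'-c'\sin\theta)\tau,\ t)$. Then \begin{align*} p(P)&=-\hat p_{\delta c'\tau}(P')+\frac1\pi\int_0^{2\pi}\Big(p(Q(\theta))-\rho'c'u(Q(\theta))\cos\theta-\rho'c'v(Q(\theta))\sin\theta\Big)d\theta+\mathcal O(\tau^3),\\ \rho(P)&=\rho(P')+\frac{1}{c'^2}\big(p(P)-p(P')\big),\\ u(P)&=\frac1\pi\int_0^{2\pi}\Big(-\frac{p(Q(\theta))}{\rho'c'}\cos\theta+u(Q(\theta))\big(2\cos^2\theta-\tfrac12\big)+2v(Q(\theta))\sin\theta\cos\theta\Big)d\theta-\omega\big(u(P')-\hat u_{\nu c'\tau}(P')\big)+\mathcal O(\tau^3),\\ v(P)&=\frac1\pi\int_0^{2\pi}\Big(-\frac{p(Q(\theta))}{\rho'c'}\sin\theta+v(Q(\theta))\big(2\sin^2\theta-\tfrac12\big)+2u(Q(\theta))\sin\theta\cos\theta\Big)d\theta-\omega\big(v(P')-\hat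 v_{\nu c'\tau}(P')\big)+\mathcal O(\tau^3). \end{align*}
   Context: The linearized two-dimensional Euler equations in primitive variables $(\rho,u,v,p)$ with constant background state $(\rho',u',v',p')$, where $\rho'>0$, $p'>0$, $u',v'\in\mathbb{R}$, $\gamma>1$ and $c'=\sqrt{\gamma p'/\rho'}$, are $$\rho_t+u'\rho_x+v'\rho_y+\rho'(u_x+v_y)=0,$$ $$u_t+u'u_x+v'u_y+\tfrac{1}{\rho'}p_x=0,$$ $$v_t+u'v_x+v'v_y+\tfrac{1}{\rho'}p_y=0,$$ $$p_t+u'p_x+v'p_y+\gamma p'(u_x+v_y)=0.$$ Primed quantities are constants; unprimed $\rho,u,v,p$ are the components of the solution. For a function $f$ of the spatial variables, a point $(x_0,y_0)\in\mathbb{R}^2$ and $R\ge0$, let $\mathbf Q_R(\theta)=(x_0+R\cos\theta,\,y_0+R\sin\theta)$ and $$\hat f_R(x_0,y_0)=\frac13\left(\frac{4}{2\pi}\int_0^{2\pi}f(\mathbf Q_{R/2}(\theta))\,d\theta-\frac{1}{2\pi}\int_0^{2\pi}f(\mathbf Q_R(\theta))\,d\theta\right)$$ (so $\hat f_0=f$). The quantities $\hat p_{\delta c'\tau}(P')$, $\hat u_{\nu c'\tau}(P')$, $\hat v_{\nu c'\tau}(P')$ are obtained by applying this to $p(\cdot,\cdot,t)$, $u(\cdot,\cdot,t)$, $v(\cdot,\cdot,t)$ at the spatial position $(x-u'\tau,y-v'\tau)$ of $P'$, with radius $\delta c'\tau$ or $\nu c'\tau$ respectively. The Active Flux method is a finite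 volume type method on a Cartesian grid whose degrees of freedom are cell averages and point values at cell corners and edge midpoints; the evolution operator is used to update the point values over times $\tau\in(0,\Delta t]$. The formulas with the $\mathcal O(\tau^3)$ terms dropped define the approximate evolution operator $\mathrm{EG2}^{\omega}_{\delta,\nu}$; the case $\omega=0$ is called $\mathrm{EG2}_\delta$ and the case $\omega=1$ is called $\mathrm{EG2}_{\delta,\nu}$. The $\mathcal O(\tau^3)$ is as $\tau\to0^+$, for the fixed solution, fixed $(x,y,t)$ and fixed $\delta,\nu,\omega$. *)

(* Defs.v *)
From Stdlib Require Import Reals.
From Coquelicot Require Import Coquelicot.
Open Scope R_scope.

(* Fields are functions of (x, y, t).  They are total, but only their values
   for 0 <= t < T are ever constrained or used: all limits below are taken
   within that domain, so time derivatives at t = 0 are one-sided. *)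
Definition field := R -> R -> R -> R.

Definition domain (T : R) (q : R * R * R) : Prop := 0 <= snd q < T.

Definition d_x (f : field) : field := fun x y t => Derive (fun s => f s y t) x.

Definition d_y (f : field) : field := fun x y t => Derive (fun s => f x s t) y.

Definition is_d_t (T : R) (f : field) (x y t l : R) : Prop :=
  filterlim (fun s => (f x y s - f x y t) / (s - t))
    (within (fun s => 0 <= s < T /\ s <> t) (locally t)) (locally l).

(* The unique l with is_d_t T f x y t l when there is one, as for RInt. *)
Definition d_t (T : R) (f : field) : field :=
  fun x y t => iota (is_d_t T f x y t).

(* f is C^k on R^2 x [0,T): all partial derivatives of order at most k, in
   any order of differentiation, exist and are jointly continuous there. *)
Fixpoint class_C (k : nat) (T : R) (f : field) : Prop :=
  continuous_on (domain T) (fun q => f (fst (fst q)) (snd (fst q)) (snd q)) /\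
  match k with
  | O => True
  | S j =>
      (forall x y t, 0 <= t < T ->
         ex_derive (fun s => f s y t) x /\
         ex_derive (fun s => f x s t) y /\
         exists l, is_d_t T f x y t l) /\
      class_C j T (d_x f) /\ class_C j T (d_y f) /\ class_C j T (d_t T f)
  end.

Definition sound_speed (gamma rho' p' : R) : R := sqrt (gamma * p' / rho').

Definition linearized_euler (gamma rho' u' v' p' T : R)
    (rho u v p : field) : Prop :=
  forall x y t, 0 <= t < T ->
    d_t T rho x y t + u' * d_x rho x y t + v' * d_y rho x y t
      + rho' * (d_x u x y t + d_y v x y t) = 0 /\
    d_t T u x y t + u' * d_x u x y t + v' * d_y u x y t
      + 1 / rho' * d_x p x y t = 0 /\
    d_t T v x y t + u' * d_x v x y t + v' * d_y v x y t
      + 1 / rho' * d_y p x y t = 0 /\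
    d_t T p x y t + u' * d_x p x y t + v' * d_y p x y t
      + gamma * p' * (d_x u x y t + d_y v x y t) = 0.

Definition hat (f : R -> R -> R) (r x0 y0 : R) : R :=
  1 / 3 *
  (4 / (2 * PI) *
     RInt (fun th => f (x0 + r / 2 * cos th) (y0 + r / 2 * sin th)) 0 (2 * PI)
   - 1 / (2 * PI) *
     RInt (fun th => f (x0 + r * cos th) (y0 + r * sin th)) 0 (2 * PI)).

(* f(tau) = g(tau) + O(tau^3) as tau -> 0+, for tau subject to D. *)
Definition eq_O3 (D : R -> Prop) (f g : R -> R) : Prop :=
  exists C : R,
    within D (at_right 0) (fun tau => Rabs (f tau - g tau) <= C * tau ^ 3).

(* Main.v *)
Require Import Defs.
From Stdlib Require Import Reals Factorial Lra Lia.
From Coquelicot Require Import Coquelicot.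
Open Scope R_scope.

(** The linearized Euler operator has constant coefficients, so a C^3 solution
    can be expanded to second order both in time at [(x, y, t)] and in space
    along the directions that lead to the points of the bicharacteristic
    circle.  The second time derivatives reduce to spatial ones through the
    equations and Schwarz's theorem; averaging the spatial expansions against
    the trigonometric weights yields the same quadratic polynomial in [tau].
    The formula for the density is exact because [rho - p / c'^2] is
    transported by the background flow. *)

(** The fields are constrained only for [0 <= t < T], and at [t = 0] time derivatives are one-sided.
    Hence everything in time is done along rays [(x + a s, y + b s, t + c s)] with [c >= 0] and
    [s > 0]. A single Taylor expansion on such rays serves twice: direction [(0, 0, 1)] gives the
    expansion at [P], directions [(a, b, 0)] those at the points of a circle, where the remainder
    must be uniform in the direction. The constants come from the wave structure. With [D] the
    derivative along the background flow, [D^2 p = c'^2 Laplace p] and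
    [D^2 (u, v) = c'^2 grad div (u, v)]. The mean of [p] over the circle of radius [c' tau] carries
    [c'^2 tau^2 / 4] times the Laplacian, while [c'^2 tau^2 / 2] is required; twice the mean minus a
    value at the centre repairs this. Against [dtheta / PI], the weight [2 cos^2 - 1/2] has total
    mass 1, retains [u_xx] and kills [u_yy], and [2 sin cos] contributes exactly [v_xy]: together
    the first component of [grad div]. *)

(** * Differential calculus on the half-open time domain *)

Lemma class_C_cont (k : nat) (T : R) (f : field) :
  class_C k T f ->
  forall x y t, 0 <= t < T -> forall eps, 0 < eps ->
  exists d, 0 < d /\ forall x1 y1 t1,
    Rabs (x1 - x) < d -> Rabs (y1 - y) < d -> Rabs (t1 - t) < d ->
    0 <= t1 < T -> Rabs (f x1 y1 t1 - f x y t) < eps.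
Proof.
intros Hf x y t Ht eps Heps.
assert (H : continuous_on (Defs.domain T)
  (fun q => f (fst (fst q)) (snd (fst q)) (snd q))) by (destruct k; apply Hf).
assert (H1 := H (x, y, t) Ht).
destruct (proj1 (filterlim_locally _ _) H1 (mkposreal _ Heps)) as [d Hd].
exists d; split; [apply cond_pos|].
intros x1 y1 t1 Hx Hy Ht1 HD.
apply (Hd (x1, y1, t1)); [|exact HD].
split; [split|]; assumption.
Qed.

Lemma class_C_pred (k : nat) (T : R) (f : field) :
  class_C (S k) T f -> class_C k T f.
Proof.
revert f; induction k as [|k IH]; intros f [Hc [Hd [Hx [Hy Ht]]]].
- split; [exact Hc | exact I].
- split; [exact Hc|]; split; [exact Hd|].
  repeat split; apply IH; assumption.
Qed.

(** Since [t < T], there is always room to the right of [t], even at [t = 0]. Properness makes the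
    limit unique, so that [iota] in [d_t] really selects it. *)
Lemma is_d_t_proper (T t : R) : 0 <= t < T ->
  ProperFilter' (within (fun s => 0 <= s < T /\ s <> t) (locally t)).
Proof.
intros Ht; apply Build_ProperFilter'; [|apply within_filter, locally_filter].
intros [d Hd].
assert (Hm : 0 < Rmin d (T - t))
  by (apply Rmin_glb_lt; [apply cond_pos | lra]).
assert (H1 := Rmin_l d (T - t)); assert (H2 := Rmin_r d (T - t)).
apply (Hd (t + Rmin d (T - t) / 2)); [|lra].
change (Rabs (t + Rmin d (T - t) / 2 - t) < d).
rewrite Rabs_pos_eq; lra.
Qed.

Lemma is_d_t_unique (T : R) (f : field) (x y t l : R) :
  0 <= t < T -> is_d_t T f x y t l -> d_t T f x y t = l.
Proof.
intros Ht Hl.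
assert (P := is_d_t_proper T t Ht).
exact (iota_filterlim_locally _ _ Hl).
Qed.

Lemma class_C_d_t (k : nat) (T : R) (f : field) (x y t : R) :
  class_C (S k) T f -> 0 <= t < T -> is_d_t T f x y t (d_t T f x y t).
Proof.
intros [_ [H _]] Ht.
destruct (H x y t Ht) as [_ [_ [l Hl]]].
now rewrite (is_d_t_unique T f x y t l).
Qed.

(** The quotient is cleared so that the bound also holds at [h = 0] and can be added to the
    increments in space. *)
Lemma is_d_t_eps (T : R) (f : field) (x y t l : R) :
  is_d_t T f x y t l -> forall eps, 0 < eps ->
  exists d, 0 < d /\ forall h, Rabs h < d -> 0 <= t + h < T ->
    Rabs (f x y (t + h) - f x y t - l * h) <= eps * Rabs h.
Proof.
intros Hl eps Heps.
destruct (proj1 (filterlim_locally _ _) Hl (mkposreal _ Heps)) as [d Hd].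
exists d; split; [apply cond_pos|]; intros h Hh HD.
destruct (Req_dec h 0) as [->|Hh0].
{ rewrite Rplus_0_r, Rmult_0_r, !Rminus_diag, Rabs_R0; lra. }
assert (H : Rabs ((f x y (t + h) - f x y t) / (t + h - t) - l) < eps).
{ apply Hd; [|split; lra].
  change (Rabs (t + h - t) < d); now replace (t + h - t) with h by ring. }
replace (f x y (t + h) - f x y t - l * h)
  with (((f x y (t + h) - f x y t) / (t + h - t) - l) * h) by (field; lra).
rewrite Rabs_mult; apply Rmult_le_compat_r; [apply Rabs_pos | lra].
Qed.

Lemma increment_le (g : R -> R) (x l d eps h : R) :
  (forall z, ex_derive g z) ->
  (forall z, Rabs (z - x) < d -> Rabs (Derive g z - l) < eps) ->
  Rabs h < d -> Rabs (g (x + h) - g x - l * h) <= eps * Rabs h.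
Proof.
intros Hg Hl Hh.
destruct (MVT_gen g x (x + h) (Derive g)) as [z [Hz E]].
- intros z _; apply Derive_correct, Hg.
- intros z _; apply continuity_pt_filterlim, (ex_derive_continuous g), Hg.
- rewrite E; replace (Derive g z * (x + h - x) - l * h)
    with ((Derive g z - l) * h) by ring.
  rewrite Rabs_mult; apply Rmult_le_compat_r; [apply Rabs_pos|].
  apply Rlt_le, Hl; apply Rle_lt_trans with (2 := Hh).
  revert Hz; unfold Rmin, Rmax; destruct (Rle_dec x (x + h)); intros Hz;
    unfold Rabs; destruct (Rcase_abs (z - x)), (Rcase_abs h); lra.
Qed.

(** The increment is split into a leg in [x], one in [y] and one in time, the time leg being the one
    attached to [(x, y, t)]. The space legs use the mean value theorem and continuity of the
    partials; the time leg needs only the derivative at the base point, which may be one-sided. *)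
Lemma class_C_increment (k : nat) (T : R) (f : field) (x y t : R) :
  class_C (S k) T f -> 0 <= t < T -> forall eps, 0 < eps ->
  exists d, 0 < d /\ forall dx dy dt,
    Rabs dx < d -> Rabs dy < d -> Rabs dt < d -> 0 <= t + dt < T ->
    Rabs (f (x + dx) (y + dy) (t + dt) - f x y t
          - (d_x f x y t * dx + d_y f x y t * dy + d_t T f x y t * dt))
    <= eps * (Rabs dx + Rabs dy + Rabs dt).
Proof.
intros Hf Ht eps Heps.
assert (Hdt := class_C_d_t k T f x y t Hf Ht).
destruct Hf as [_ [Hd [Hx [Hy _]]]].
destruct (class_C_cont k T _ Hx x y t Ht eps Heps) as [d1 [Hd1 H1]].
destruct (class_C_cont k T _ Hy x y t Ht eps Heps) as [d2 [Hd2 H2]].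
destruct (is_d_t_eps _ _ _ _ _ _ Hdt eps Heps) as [d3 [Hd3 H3]].
exists (Rmin d1 (Rmin d2 d3)); split; [repeat apply Rmin_glb_lt; assumption|].
intros dx dy dt Hdx Hdy Hdt' HD.
assert (M1 := Rmin_l d1 (Rmin d2 d3)); assert (M2 := Rmin_r d1 (Rmin d2 d3)).
assert (M3 := Rmin_l d2 d3); assert (M4 := Rmin_r d2 d3).
assert (E1 := increment_le (fun z => f z (y + dy) (t + dt)) x (d_x f x y t)
  d1 eps dx).
assert (E2 := increment_le (fun z => f x z (t + dt)) y (d_y f x y t)
  d2 eps dy).
assert (E3 := H3 dt).
assert (B1 : Rabs (f (x + dx) (y + dy) (t + dt) - f x (y + dy) (t + dt)
  - d_x f x y t * dx) <= eps * Rabs dx).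
{ apply E1; [intros z; exact (proj1 (Hd z _ _ HD)) | | lra].
  intros z Hz; apply (H1 z (y + dy) (t + dt)); trivial.
  - replace (y + dy - y) with dy by ring; lra.
  - replace (t + dt - t) with dt by ring; lra. }
assert (B2 : Rabs (f x (y + dy) (t + dt) - f x y (t + dt)
  - d_y f x y t * dy) <= eps * Rabs dy).
{ apply E2; [intros z; exact (proj1 (proj2 (Hd x z _ HD))) | | lra].
  intros z Hz; apply (H2 x z (t + dt)); trivial.
  - rewrite Rminus_diag, Rabs_R0; lra.
  - replace (t + dt - t) with dt by ring; lra. }
assert (B3 : Rabs (f x y (t + dt) - f x y t - d_t T f x y t * dt)
  <= eps * Rabs dt) by (apply E3; [lra | assumption]).
apply Rabs_le_between in B1; apply Rabs_le_between in B2.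
apply Rabs_le_between in B3; apply Rabs_le_between; lra.
Qed.

(** The derivative is two-sided although time may start at 0: for [s > 0] and [c >= 0], small
    changes of [s] of either sign keep the ray in the domain. *)
Lemma is_derive_ray (k : nat) (T : R) (f : field) (x y t a b c s : R) :
  class_C (S k) T f -> 0 <= t -> 0 <= c -> 0 < s -> t + c * s < T ->
  is_derive (fun s => f (x + a * s) (y + b * s) (t + c * s)) s
    (a * d_x f (x + a * s) (y + b * s) (t + c * s)
     + b * d_y f (x + a * s) (y + b * s) (t + c * s)
     + c * d_t T f (x + a * s) (y + b * s) (t + c * s)).
Proof.
intros Hf Ht Hc Hs HT.
assert (Hcs : 0 <= c * s) by (apply Rmult_le_pos; lra).
apply is_derive_Reals; intros eps Heps.
(* [K] dominates the speed of the ray; the tolerance [eps / (2 * K)] leaves [eps / 2], hence a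
   strict inequality at the end. *)
set (K := Rabs a + Rabs b + c + 1).
assert (Ha := Rabs_pos a); assert (Hb := Rabs_pos b).
assert (HK : 0 < K) by (unfold K; lra).
assert (He : 0 < eps / (2 * K)) by (apply Rdiv_lt_0_compat; lra).
destruct (class_C_increment k T f (x + a * s) (y + b * s) (t + c * s) Hf
  (conj (Rplus_le_le_0_compat _ _ Ht Hcs) HT) _ He) as [d [Hd H]].
(* The three bounds on [h] keep [s + h >= 0], the displacement below [d], and the time below [T]. *)
set (m := Rmin s (Rmin (d / K) ((T - (t + c * s)) / K))).
assert (Hm : 0 < m).
{ repeat apply Rmin_glb_lt; trivial; apply Rdiv_lt_0_compat; lra. }
exists (mkposreal _ Hm); intros h Hh0 Hh; simpl in Hh.
assert (M1 := Rle_trans _ _ _ (Rlt_le _ _ Hh) (Rmin_l _ _)).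
assert (M2 := Rlt_le_trans _ _ _ Hh (Rmin_r _ _)).
assert (M3 := Rlt_le_trans _ _ _ M2 (Rmin_l _ _)).
assert (M4 := Rlt_le_trans _ _ _ M2 (Rmin_r _ _)).
apply (Rlt_div_r _ _ _ HK) in M3; apply (Rlt_div_r _ _ _ HK) in M4.
assert (Hp := Rabs_pos h).
assert (Hh' := proj1 (Rabs_le_between _ _) (Rle_refl (Rabs h))).
assert (A1 : Rabs (a * h) <= Rabs h * K)
  by (rewrite Rabs_mult, Rmult_comm; apply Rmult_le_compat_l; unfold K; lra).
assert (A2 : Rabs (b * h) <= Rabs h * K)
  by (rewrite Rabs_mult, Rmult_comm; apply Rmult_le_compat_l; unfold K; lra).
assert (A3 : Rabs (c * h) <= Rabs h * K)
  by (rewrite Rabs_mult, (Rabs_pos_eq c Hc), Rmult_comm;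
      apply Rmult_le_compat_l; unfold K; lra).
assert (B : 0 <= t + c * s + c * h < T).
{ assert (0 <= c * (s + h)) by (apply Rmult_le_pos; lra).
  apply Rabs_le_between in A3; split; lra. }
specialize (H (a * h) (b * h) (c * h) ltac:(lra) ltac:(lra) ltac:(lra) B).
rewrite !(Rmult_plus_distr_l _ s h), <- !Rplus_assoc.
match type of H with Rabs (?u - ?v - ?w) <= _ =>
  match goal with |- Rabs ((?u' - ?v') / h - ?z) < _ =>
    replace ((u' - v') / h - z) with ((u - v - w) / h) by (field; exact Hh0)
  end end.
unfold Rdiv at 1; rewrite Rabs_mult, Rabs_inv.
assert (Hh1 : 0 < Rabs h) by (apply Rabs_pos_lt; exact Hh0).
apply (proj2 (Rlt_div_l _ eps (Rabs h) Hh1)).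
apply Rle_lt_trans with (1 := H).
apply Rle_lt_trans with (eps / (2 * K) * (Rabs h * K)).
{ apply Rmult_le_compat_l; [lra|].
  rewrite !Rabs_mult, (Rabs_pos_eq c Hc); unfold K; lra. }
replace (eps / (2 * K) * (Rabs h * K)) with (eps * Rabs h / 2) by (field; lra).
assert (0 < eps * Rabs h) by (apply Rmult_lt_0_compat; lra).
lra.
Qed.

(** Only right continuity is available at 0, so the mean value theorem is applied on [[e, tau]] with
    [e] small, and the gap from 0 to [e] is absorbed in [eps]. *)
Lemma mean_value_bound (h dh : R -> R) (n : nat) (C tau : R) :
  0 < tau -> 0 <= C ->
  (forall s, 0 < s <= tau -> is_derive h s (dh s)) ->
  (forall eps, 0 < eps ->
     exists d, 0 < d /\ forall s, 0 < s < d -> Rabs (h s - h 0) < eps) ->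
  (forall s, 0 < s <= tau -> Rabs (dh s) <= C * s ^ n) ->
  Rabs (h tau - h 0) <= C * tau ^ S n.
Proof.
intros Htau HC Hd Hc Hb.
apply le_epsilon; intros eps Heps.
destruct (Hc eps Heps) as [d [Hd0 H]].
set (e := Rmin d tau / 2).
assert (M1 := Rmin_l d tau); assert (M2 := Rmin_r d tau).
assert (M3 : 0 < Rmin d tau) by (apply Rmin_glb_lt; lra).
assert (He : 0 < e < d /\ e < tau) by (unfold e; lra).
destruct (MVT_gen h e tau dh) as [z [Hz E]].
- rewrite Rmin_left, Rmax_right by lra; intros z Hz; apply Hd; lra.
- rewrite Rmin_left, Rmax_right by lra; intros z Hz.
  apply continuity_pt_filterlim, (ex_derive_continuous h).
  exists (dh z); apply Hd; lra.
- rewrite Rmin_left, Rmax_right in Hz by lra.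
  specialize (H e (proj1 He)).
  assert (Hz' : 0 < z <= tau) by lra.
  specialize (Hb z Hz').
  assert (P : z ^ n <= tau ^ n) by (apply pow_incr; lra).
  assert (P0 : 0 <= z ^ n) by (apply pow_le; lra).
  assert (Q : Rabs (h tau - h e) <= C * tau ^ S n).
  { rewrite E, Rabs_mult, (Rabs_pos_eq (tau - e)) by lra; simpl.
    replace (C * (tau * tau ^ n)) with (C * tau ^ n * tau) by ring.
    apply Rmult_le_compat; [apply Rabs_pos | lra | | lra].
    apply Rle_trans with (1 := Hb); apply Rmult_le_compat_l; assumption. }
  replace (h tau - h 0) with ((h tau - h e) + (h e - h 0)) by ring.
  apply Rle_trans with (1 := Rabs_triang _ _); lra.
Qed.

(** * Taylor expansion along rays *)

(** This is [(a d_x + b d_y + c d_t)^n f] at the base point. The recursion differentiates the field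
    and leaves the point fixed, so no commutation of partials is involved. *)
Fixpoint ray_jet (T a b c x y t : R) (n : nat) (f : field) : R :=
  match n with
  | O => f x y t
  | S k => a * ray_jet T a b c x y t k (d_x f)
           + b * ray_jet T a b c x y t k (d_y f)
           + c * ray_jet T a b c x y t k (d_t T f)
  end.

(* [n] terms, hence degree [n - 1]. *)
Fixpoint ray_taylor (T a b c x y t : R) (n : nat) (f : field) (s : R) : R :=
  match n with
  | O => 0
  | S k => ray_taylor T a b c x y t k f s
           + / INR (fact k) * ray_jet T a b c x y t k f * s ^ k
  end.

(** The polynomial obeys the same rule as the field along the ray: its derivative combines the
    polynomials of the three partials, with one term less. This makes the induction on the remainder
    close. *)
Lemma is_derive_ray_taylor (T a b c x y t : R) (n : nat) (f : field) (s : R) :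
  is_derive (ray_taylor T a b c x y t (S n) f) s
    (a * ray_taylor T a b c x y t n (d_x f) s
     + b * ray_taylor T a b c x y t n (d_y f) s
     + c * ray_taylor T a b c x y t n (d_t T f) s).
Proof.
induction n as [|n IH].
- simpl; auto_derive; [trivial | ring].
- apply (is_derive_ext (fun s => ray_taylor T a b c x y t (S n) f s
    + / INR (fact (S n)) * ray_jet T a b c x y t (S n) f * s ^ S n));
    [reflexivity|].
  assert (Hpow : forall K, is_derive (fun s => K * s ^ S n) s
    (K * (INR (S n) * s ^ n))).
  { intros K; auto_derive; [trivial | now rewrite Rmult_1_l]. }
  evar_last.
  { apply (is_derive_plus (ray_taylor T a b c x y t (S n) f)
      (fun s => / INR (fact (S n)) * ray_jet T a b c x y t (S n) f * s ^ S n));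
      [exact IH | apply Hpow]. }
  assert (Hn := INR_fact_neq_0 n).
  assert (Hn' : INR (S n) <> 0) by (apply not_0_INR; discriminate).
  rewrite fact_simpl, mult_INR.
  change (plus ?u ?v) with (u + v).
  simpl ray_jet; cbn [ray_taylor]; field; split; assumption.
Qed.

Lemma ray_taylor_0 (T a b c x y t : R) (n : nat) (f : field) :
  ray_taylor T a b c x y t (S n) f 0 = f x y t.
Proof.
induction n as [|n IH]; [simpl; field|].
change (ray_taylor T a b c x y t (S n) f 0
  + / INR (fact (S n)) * ray_jet T a b c x y t (S n) f * 0 ^ S n = f x y t).
rewrite IH, pow_i by lia; ring.
Qed.

Lemma ray_near (x y t M d : R) : 0 < M -> forall a b c s,
  Rabs a <= M -> Rabs b <= M -> 0 <= c <= M -> 0 < s < d / M ->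
  Rabs (x + a * s - x) < d /\ Rabs (y + b * s - y) < d
  /\ Rabs (t + c * s - t) < d.
Proof.
intros HM a b c s Ha Hb Hc [Hs0 Hs].
apply (Rlt_div_r _ _ _ HM) in Hs.
assert (K : forall z w, Rabs w <= M -> Rabs (z + w * s - z) < d).
{ intros z w Hw; replace (z + w * s - z) with (w * s) by ring.
  rewrite Rabs_mult, (Rabs_pos_eq s) by lra.
  assert (Rabs w * s <= M * s) by (apply Rmult_le_compat_r; lra).
  lra. }
repeat split; apply K; trivial; rewrite Rabs_pos_eq; lra.
Qed.

Lemma ray_right_continuous (k : nat) (T : R) (f : field) (x y t a b c : R) :
  class_C k T f -> 0 <= t < T -> 0 <= c -> forall eps, 0 < eps ->
  exists d, 0 < d /\ forall s, 0 < s < d -> t + c * s < T ->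
    Rabs (f (x + a * s) (y + b * s) (t + c * s) - f x y t) < eps.
Proof.
intros Hf Ht Hc eps Heps.
destruct (class_C_cont _ T f Hf x y t Ht eps Heps) as [d [Hd H]].
assert (Ha := Rabs_pos a); assert (Hb := Rabs_pos b).
exists (d / (Rabs a + Rabs b + c + 1)).
split; [apply Rdiv_lt_0_compat; lra|].
intros s Hs HT.
destruct (ray_near x y t (Rabs a + Rabs b + c + 1) d ltac:(lra) a b c s
  ltac:(lra) ltac:(lra) ltac:(lra) Hs) as [N1 [N2 N3]].
assert (0 <= c * s) by (apply Rmult_le_pos; lra).
apply H; trivial; lra.
Qed.

(* The bound is uniform in the direction, so that it can be integrated over
   a circle of directions. *)
Lemma ray_taylor_remainder (n : nat) (T : R) (f : field) (x y t M : R) :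
  class_C n T f -> 0 <= t < T -> 0 < M ->
  exists C d, 0 <= C /\ 0 < d /\ forall a b c s,
    Rabs a <= M -> Rabs b <= M -> 0 <= c <= M -> 0 < s < d -> t + c * s < T ->
    Rabs (f (x + a * s) (y + b * s) (t + c * s)
          - ray_taylor T a b c x y t n f s) <= C * s ^ n.
Proof.
intros Hf Ht HM.
revert f Hf; induction n as [|n IH]; intros f Hf.
(* With no Taylor terms the claim is local boundedness; the tolerance 1 yields the constant
   [Rabs (f x y t) + 1]. *)
- destruct (class_C_cont 0 T f Hf x y t Ht 1 Rlt_0_1) as [d [Hd H]].
  exists (Rabs (f x y t) + 1), (d / M).
  split; [assert (K := Rabs_pos (f x y t)); lra|].
  split; [apply Rdiv_lt_0_compat; assumption|].
  intros a b c s Ha Hb Hc Hs HT.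
  destruct (ray_near x y t M d HM a b c s Ha Hb Hc Hs) as [N1 [N2 N3]].
  assert (0 <= c * s) by (apply Rmult_le_pos; lra).
  specialize (H _ _ _ N1 N2 N3 ltac:(lra)).
  simpl; rewrite Rminus_0_r, Rmult_1_r.
  replace (f (x + a * s) (y + b * s) (t + c * s))
    with (f (x + a * s) (y + b * s) (t + c * s) - f x y t + f x y t) by ring.
  apply Rle_trans with (1 := Rabs_triang _ _); lra.
- destruct (proj2 Hf) as [_ [Hx [Hy Htt]]].
  destruct (IH _ Hx) as [C1 [d1 [HC1 [Hd1 H1]]]].
  destruct (IH _ Hy) as [C2 [d2 [HC2 [Hd2 H2]]]].
  destruct (IH _ Htt) as [C3 [d3 [HC3 [Hd3 H3]]]].
  (* The derivative of the remainder of [f] is the combination, with coefficients at most [M], of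
     the remainders of its partials; integrating from 0 gains one power of [s]. *)
  exists (M * (C1 + C2 + C3)), (Rmin d1 (Rmin d2 d3)).
  split; [apply Rmult_le_pos; lra|].
  split; [repeat apply Rmin_glb_lt; assumption|].
  intros a b c s Ha Hb Hc Hs HT.
  assert (M1 := Rmin_l d1 (Rmin d2 d3)); assert (M2 := Rmin_r d1 (Rmin d2 d3)).
  assert (M3 := Rmin_l d2 d3); assert (M4 := Rmin_r d2 d3).
  set (F := fun f s => f (x + a * s) (y + b * s) (t + c * s)
                       - ray_taylor T a b c x y t (S n) f s).
  set (G := fun f s => f (x + a * s) (y + b * s) (t + c * s)
                       - ray_taylor T a b c x y t n f s).
  assert (HT' : forall r, 0 < r <= s -> 0 <= c * r <= c * s).
  { intros r Hr; split; [apply Rmult_le_pos | apply Rmult_le_compat_l]; lra. }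
  assert (F0 : F f 0 = 0).
  { unfold F; rewrite ray_taylor_0, !Rmult_0_r, !Rplus_0_r; ring. }
  change (Rabs (F f s) <= M * (C1 + C2 + C3) * s ^ S n).
  rewrite <- (Rminus_0_r (F f s)), <- F0.
  apply (mean_value_bound (F f)
    (fun r => a * G (d_x f) r + b * G (d_y f) r + c * G (d_t T f) r)).
  + lra.
  + apply Rmult_le_pos; lra.
  + intros r Hr; evar_last.
    * apply (is_derive_minus
        (fun s => f (x + a * s) (y + b * s) (t + c * s))
        (ray_taylor T a b c x y t (S n) f)).
      -- apply (is_derive_ray n T f); trivial; try lra.
         specialize (HT' r Hr); lra.
      -- apply is_derive_ray_taylor.
    * unfold G, minus, plus, opp; simpl; ring.
  + intros eps Heps; rewrite F0.
    assert (Heps2 : 0 < eps / 2) by lra.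
    destruct (ray_right_continuous _ T f x y t a b c Hf Ht (proj1 Hc) _ Heps2)
      as [d [Hd H]].
    assert (Hcont : continuous (ray_taylor T a b c x y t (S n) f) 0).
    { apply (ex_derive_continuous (ray_taylor T a b c x y t (S n) f)).
      eexists; apply is_derive_ray_taylor. }
    destruct (proj1 (filterlim_locally _ _) Hcont (mkposreal _ Heps2))
      as [d' Hd'].
    exists (Rmin s (Rmin d d')).
    assert (Hd'0 := cond_pos d').
    split; [repeat apply Rmin_glb_lt; lra|].
    intros r Hr.
    assert (R1 := Rmin_l s (Rmin d d')).
    assert (R2 := Rmin_r s (Rmin d d')).
    assert (R3 := Rmin_l d d'); assert (R4 := Rmin_r d d').
    specialize (HT' r ltac:(lra)).
    specialize (H r ltac:(lra) ltac:(lra)).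
    assert (Hball : ball 0 d' r).
    { change (Rabs (r - 0) < d'); rewrite Rabs_pos_eq; lra. }
    specialize (Hd' r Hball).
    change (Rabs (ray_taylor T a b c x y t (S n) f r
                  - ray_taylor T a b c x y t (S n) f 0) < eps / 2) in Hd'.
    rewrite ray_taylor_0 in Hd'; unfold F.
    apply Rabs_lt_between in H; apply Rabs_lt_between in Hd'.
    apply Rabs_lt_between; lra.
  + intros r Hr; specialize (HT' r Hr).
    specialize (H1 a b c r Ha Hb Hc ltac:(lra) ltac:(lra)).
    specialize (H2 a b c r Ha Hb Hc ltac:(lra) ltac:(lra)).
    specialize (H3 a b c r Ha Hb Hc ltac:(lra) ltac:(lra)).
    fold (G (d_x f) r) in H1; fold (G (d_y f) r) in H2.
    fold (G (d_t T f) r) in H3.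
    replace (M * (C1 + C2 + C3) * r ^ n)
      with (M * (C1 * r ^ n) + M * (C2 * r ^ n) + M * (C3 * r ^ n)) by ring.
    apply Rle_trans with (1 := Rabs_triang _ _).
    apply Rplus_le_compat; [apply Rle_trans with (1 := Rabs_triang _ _);
      apply Rplus_le_compat|]; rewrite Rabs_mult;
      apply Rmult_le_compat; try apply Rabs_pos; trivial.
    rewrite Rabs_pos_eq; lra.
Qed.

(** * Symmetry of mixed derivatives up to the initial time *)

(** Exchanging the space variables exchanges [d_x] and [d_y] and keeps [d_t]; commutation of [d_y]
    with [d_t] is thereby reduced to that of [d_x]. *)
Definition swap_xy (f : field) : field := fun x y t => f y x t.

Lemma class_C_swap_xy (k : nat) (T : R) (f : field) :
  class_C k T f -> class_C k T (swap_xy f).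
Proof.
revert f; induction k as [|k IH]; intros f Hf.
all: assert (Hc : continuous_on (Defs.domain T)
  (fun q => swap_xy f (fst (fst q)) (snd (fst q)) (snd q))).
1, 3: intros [[x y] t] Ht; apply filterlim_locally; intros eps;
  destruct (class_C_cont _ T f Hf y x t Ht eps (cond_pos eps)) as [d [Hd H]];
  exists (mkposreal d Hd); intros [[x1 y1] t1] [[Hx Hy] Ht1] HD;
  exact (H y1 x1 t1 Hy Hx Ht1 HD).
- split; [exact Hc | exact I].
- destruct Hf as [_ [Hd [Hx [Hy Ht]]]].
  split; [exact Hc|]; split.
  + intros x y t HD; destruct (Hd y x t HD) as [D1 [D2 D3]].
    split; [exact D2|]; split; [exact D1 | exact D3].
  + split; [exact (IH _ Hy)|]; split; [exact (IH _ Hx) | exact (IH _ Ht)].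
Qed.

(** The ray of direction [(0, 0, 1)] issued from time 0 passes through [t] at a positive parameter,
    where its derivative is two-sided. *)
Lemma is_derive_d_t (k : nat) (T : R) (f : field) (x y t : R) :
  class_C (S k) T f -> 0 < t < T ->
  is_derive (fun s => f x y s) t (d_t T f x y t).
Proof.
intros Hf Ht.
assert (H := is_derive_ray k T f x y 0 0 0 1 t Hf).
rewrite !Rmult_0_l, !Rplus_0_r, Rplus_0_l, !Rmult_1_l, !Rplus_0_l in H.
apply (is_derive_ext (fun s => f (x + 0 * s) (y + 0 * s) (0 + 1 * s))).
- intros s; f_equal; ring.
- apply H; lra.
Qed.

Lemma class_C_continuity_xy (k : nat) (T : R) (f : field) (x y t : R) :
  class_C k T f -> 0 <= t < T -> continuity_2d_pt (fun u v => f u v t) x y.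
Proof.
intros Hf Ht eps.
destruct (class_C_cont k T f Hf x y t Ht eps (cond_pos eps)) as [d [Hd H]].
exists (mkposreal d Hd); intros u v Hu Hv; apply H; trivial.
rewrite Rminus_diag, Rabs_R0; exact Hd.
Qed.

Lemma d_x_d_y (k : nat) (T : R) (f : field) (x y t : R) :
  class_C (S (S k)) T f -> 0 <= t < T ->
  d_x (d_y f) x y t = d_y (d_x f) x y t.
Proof.
intros [_ [Hd [Hx [Hy _]]]] Ht.
apply (Schwarz (fun u v => f u v t)).
- exists (mkposreal _ Rlt_0_1); intros u v _ _.
  split; [exact (proj1 (Hd u v t Ht))|].
  split; [exact (proj1 (proj2 (Hd u v t Ht)))|].
  split; [exact (proj1 (proj1 (proj2 Hy) u v t Ht))|].
  exact (proj1 (proj2 (proj1 (proj2 Hx) u v t Ht))).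
- apply (class_C_continuity_xy k T (d_x (d_y f))); trivial; apply Hy.
- apply (class_C_continuity_xy k T (d_y (d_x f))); trivial; apply Hx.
Qed.

(* Schwarz's theorem needs two-sided derivatives, so it is applied at
   interior times, and the case [t = 0] follows by continuity. *)
Lemma d_x_d_t (k : nat) (T : R) (f : field) (x y t : R) :
  class_C (S (S k)) T f -> 0 <= t < T ->
  d_x (d_t T f) x y t = d_t T (d_x f) x y t.
Proof.
intros Hf.
assert (Hx : class_C (S k) T (d_x f)) by apply Hf.
assert (Ht : class_C (S k) T (d_t T f)) by apply Hf.
assert (Hxt : class_C k T (d_x (d_t T f))) by apply Ht.
assert (Htx : class_C k T (d_t T (d_x f))) by apply Hx.
assert (Hdt : forall u v, 0 < v < T ->
  Derive (fun s => f u y s) v = d_t T f u y v).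
{ intros u v Hv; apply is_derive_unique, (is_derive_d_t (S k)); assumption. }
assert (E1 : forall u v, 0 < v < T ->
  Derive (fun z => Derive (fun s => f z y s) v) u = d_x (d_t T f) u y v).
{ intros u v Hv; apply Derive_ext; intros z; apply Hdt, Hv. }
assert (E2 : forall u v, 0 < v < T ->
  Derive (fun z => Derive (fun s => f s y z) u) v = d_t T (d_x f) u y v).
{ intros u v Hv; apply is_derive_unique, (is_derive_d_t k); assumption. }
assert (Hloc : forall s, 0 < s < T -> forall P : R -> R -> Prop,
  (forall u v, 0 < v < T -> P u v) -> locally_2d P x s).
{ intros s Hs P HP.
  assert (Hm : 0 < Rmin s (T - s)) by (apply Rmin_glb_lt; lra).
  exists (mkposreal _ Hm); intros u v _ Hv; apply HP; simpl in Hv.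
  assert (M1 := Rmin_l s (T - s)); assert (M2 := Rmin_r s (T - s)).
  apply Rabs_lt_between in Hv; lra. }
assert (Hcont : forall g, class_C k T g -> forall s, 0 < s < T ->
  continuity_2d_pt (fun u v => g u y v) x s).
{ intros g Hg s Hs eps.
  destruct (class_C_cont k T g Hg x y s ltac:(lra) eps (cond_pos eps))
    as [d [Hd H]].
  apply (locally_2d_impl (fun u v => Rabs (u - x) < d /\ Rabs (v - s) < d)).
  - apply (Hloc s Hs); intros u v Hv [Hu Hv']; apply H; trivial; try lra.
    rewrite Rminus_diag, Rabs_R0; exact Hd.
  - exists (mkposreal d Hd); intros u v Hu Hv; now split. }
assert (Hint : forall s, 0 < s < T ->
  d_x (d_t T f) x y s = d_t T (d_x f) x y s).
{ intros s Hs; rewrite <- E1, <- E2 by exact Hs.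
  apply (Schwarz (fun u v => f u y v)).
  - apply (Hloc s Hs); intros u v Hv.
    split; [exact (proj1 (proj1 (proj2 Hf) u y v ltac:(lra)))|].
    split; [eexists; apply (is_derive_d_t (S k) T f); eassumption|].
    split.
    + apply (ex_derive_ext (fun z => d_t T f z y v)).
      * intros z; symmetry; apply Hdt, Hv.
      * exact (proj1 (proj1 (proj2 Ht) u y v ltac:(lra))).
    + eexists; apply (is_derive_d_t k T (d_x f)); eassumption.
  - apply (continuity_2d_pt_ext_loc (fun u v => d_x (d_t T f) u y v)).
    + apply (Hloc s Hs); intros u v Hv; symmetry; apply E1, Hv.
    + now apply Hcont.
  - apply (continuity_2d_pt_ext_loc (fun u v => d_t T (d_x f) u y v)).
    + apply (Hloc s Hs); intros u v Hv; symmetry; apply E2, Hv.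
    + now apply Hcont. }
intros HD; apply Rminus_diag_uniq, Req_lt_aux; intros eps.
assert (He : 0 < eps / 2) by (assert (K := cond_pos eps); lra).
destruct (class_C_cont k T _ Hxt x y t HD _ He) as [d1 [Hd1 H1]].
destruct (class_C_cont k T _ Htx x y t HD _ He) as [d2 [Hd2 H2]].
(* The time [t + m / 2] is interior even if [t = 0], and close enough to [t] for both continuity
   bounds. *)
set (m := Rmin d1 (Rmin d2 (T - t))).
assert (Hm : 0 < m) by (repeat apply Rmin_glb_lt; lra).
assert (M1 : m <= d1) by apply Rmin_l.
assert (M2 : m <= Rmin d2 (T - t)) by apply Rmin_r.
assert (M3 := Rmin_l d2 (T - t)); assert (M4 := Rmin_r d2 (T - t)).
assert (Z : forall z, Rabs (z - z) = 0)
  by (intros z; rewrite Rminus_diag; apply Rabs_R0).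
assert (Zt : Rabs (t + m / 2 - t) = m / 2)
  by (rewrite Rabs_pos_eq; lra).
assert (D := Hint (t + m / 2) ltac:(lra)).
specialize (H1 x y (t + m / 2)); specialize (H2 x y (t + m / 2)).
rewrite !Z, Zt in H1, H2.
specialize (H1 ltac:(lra) ltac:(lra) ltac:(lra) ltac:(lra)).
specialize (H2 ltac:(lra) ltac:(lra) ltac:(lra) ltac:(lra)).
apply Rabs_lt_between in H1; apply Rabs_lt_between in H2.
apply Rabs_lt_between; lra.
Qed.

Lemma d_y_d_t (k : nat) (T : R) (f : field) (x y t : R) :
  class_C (S (S k)) T f -> 0 <= t < T ->
  d_y (d_t T f) x y t = d_t T (d_y f) x y t.
Proof.
intros Hf Ht.
exact (d_x_d_t k T (swap_xy f) y x t (class_C_swap_xy _ _ _ Hf) Ht).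
Qed.

(** * Second time derivatives from the Euler equations *)

Lemma is_d_t_ext (T : R) (f g : field) (x y t l : R) :
  0 <= t < T -> (forall s, 0 <= s < T -> f x y s = g x y s) ->
  is_d_t T f x y t l -> is_d_t T g x y t l.
Proof.
intros Ht Hfg; apply filterlim_within_ext.
intros s [Hs _]; rewrite !Hfg; trivial.
Qed.

Lemma is_d_t_plus (T : R) (f g : field) (x y t l m : R) :
  is_d_t T f x y t l -> is_d_t T g x y t m ->
  is_d_t T (fun x y t => f x y t + g x y t) x y t (l + m).
Proof.
intros Hf Hg.
apply (filterlim_ext (fun s =>
  plus ((f x y s - f x y t) / (s - t)) ((g x y s - g x y t) / (s - t)))).
- intros s; unfold plus, Rdiv; simpl; ring.
- apply (filterlim_comp_2 _ _ plus Hf Hg), (filterlim_plus l m).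
Qed.

Lemma is_d_t_scal (T : R) (a : R) (f : field) (x y t l : R) :
  is_d_t T f x y t l -> is_d_t T (fun x y t => a * f x y t) x y t (a * l).
Proof.
intros Hf.
apply (filterlim_ext (fun s => scal a ((f x y s - f x y t) / (s - t)))).
- intros s; unfold scal, Rdiv; simpl; unfold mult; simpl; ring.
- apply (filterlim_comp _ _ _ _ (scal a) _ _ _ Hf), (filterlim_scal_r a l).
Qed.

(** Four terms suffice for each of the equations for [u], [v], [p] solved for its time derivative;
    the identity may then be differentiated in any variable, in time within the domain only. *)
Lemma partials_comb (k : nat) (T : R) (g f1 f2 f3 f4 : field)
    (a1 a2 a3 a4 : R) :
  class_C (S k) T f1 -> class_C (S k) T f2 ->
  class_C (S k) T f3 -> class_C (S k) T f4 ->
  (forall x y t, 0 <= t < T ->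
     g x y t = a1 * f1 x y t + a2 * f2 x y t + a3 * f3 x y t + a4 * f4 x y t) ->
  forall x y t, 0 <= t < T ->
    d_x g x y t = a1 * d_x f1 x y t + a2 * d_x f2 x y t
                  + a3 * d_x f3 x y t + a4 * d_x f4 x y t
    /\ d_y g x y t = a1 * d_y f1 x y t + a2 * d_y f2 x y t
                     + a3 * d_y f3 x y t + a4 * d_y f4 x y t
    /\ d_t T g x y t = a1 * d_t T f1 x y t + a2 * d_t T f2 x y t
                       + a3 * d_t T f3 x y t + a4 * d_t T f4 x y t.
Proof.
intros H1 H2 H3 H4 Hg x y t Ht.
assert (D1 := proj1 (proj2 H1) x y t Ht).
assert (D2 := proj1 (proj2 H2) x y t Ht).
assert (D3 := proj1 (proj2 H3) x y t Ht).
assert (D4 := proj1 (proj2 H4) x y t Ht).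
split; [|split].
- apply is_derive_unique.
  apply (is_derive_ext (fun s => a1 * f1 s y t + a2 * f2 s y t
                                 + a3 * f3 s y t + a4 * f4 s y t)).
  { intros s; symmetry; apply Hg, Ht. }
  auto_derive; [tauto | unfold d_x; ring].
- apply is_derive_unique.
  apply (is_derive_ext (fun s => a1 * f1 x s t + a2 * f2 x s t
                                 + a3 * f3 x s t + a4 * f4 x s t)).
  { intros s; symmetry; apply Hg, Ht. }
  auto_derive; [tauto | unfold d_y; ring].
- apply is_d_t_unique; [exact Ht|].
  apply (is_d_t_ext T (fun x y t => a1 * f1 x y t + a2 * f2 x y t
                                    + a3 * f3 x y t + a4 * f4 x y t));
    [exact Ht | intros s Hs; symmetry; apply Hg, Hs |].
  apply (is_d_t_plus T (fun x y t =>
    a1 * f1 x y t + a2 * f2 x y t + a3 * f3 x y t)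
    (fun x y t => a4 * f4 x y t)).
  apply (is_d_t_plus T (fun x y t => a1 * f1 x y t + a2 * f2 x y t)
    (fun x y t => a3 * f3 x y t)).
  apply (is_d_t_plus T (fun x y t => a1 * f1 x y t)
    (fun x y t => a2 * f2 x y t)).
  all: apply is_d_t_scal; eapply class_C_d_t; eassumption.
Qed.

(** Differentiating a solved equation in time leaves terms such as [d_t T (d_x p)]; after
    commutation the solved equations apply once more inside the space derivative. Mixed space
    derivatives are normalised to [d_x (d_y _)]. *)
Lemma euler_d_t_d_t (gamma rho' u' v' p' T : R) (rho u v p : field)
    (x y t : R) :
  class_C 3 T u -> class_C 3 T v -> class_C 3 T p ->
  linearized_euler gamma rho' u' v' p' T rho u v p -> 0 <= t < T ->
  d_t T (d_t T p) x y t =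
    u' ^ 2 * d_x (d_x p) x y t + 2 * u' * v' * d_x (d_y p) x y t
    + v' ^ 2 * d_y (d_y p) x y t
    + 2 * (gamma * p') * u' * (d_x (d_x u) x y t + d_x (d_y v) x y t)
    + 2 * (gamma * p') * v' * (d_x (d_y u) x y t + d_y (d_y v) x y t)
    + gamma * p' * (1 / rho') * (d_x (d_x p) x y t + d_y (d_y p) x y t)
  /\ d_t T (d_t T u) x y t =
    u' ^ 2 * d_x (d_x u) x y t + 2 * u' * v' * d_x (d_y u) x y t
    + v' ^ 2 * d_y (d_y u) x y t
    + 2 * (1 / rho') * (u' * d_x (d_x p) x y t + v' * d_x (d_y p) x y t)
    + gamma * p' * (1 / rho') * (d_x (d_x u) x y t + d_x (d_y v) x y t)
  /\ d_t T (d_t T v) x y t =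
    u' ^ 2 * d_x (d_x v) x y t + 2 * u' * v' * d_x (d_y v) x y t
    + v' ^ 2 * d_y (d_y v) x y t
    + 2 * (1 / rho') * (u' * d_x (d_y p) x y t + v' * d_y (d_y p) x y t)
    + gamma * p' * (1 / rho') * (d_x (d_y u) x y t + d_y (d_y v) x y t).
Proof.
intros Hu Hv Hp HE Ht.
assert (Hux : class_C 2 T (d_x u)) by apply Hu.
assert (Huy : class_C 2 T (d_y u)) by apply Hu.
assert (Hvx : class_C 2 T (d_x v)) by apply Hv.
assert (Hvy : class_C 2 T (d_y v)) by apply Hv.
assert (Hpx : class_C 2 T (d_x p)) by apply Hp.
assert (Hpy : class_C 2 T (d_y p)) by apply Hp.
assert (Ep : forall x y t, 0 <= t < T ->
  d_t T p x y t = - u' * d_x p x y t + - v' * d_y p x y t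
    + - (gamma * p') * d_x u x y t + - (gamma * p') * d_y v x y t).
{ intros a b s Hs; destruct (HE a b s Hs) as [_ [_ [_ E]]]; lra. }
(* The velocity equations have three terms on the right; a zero multiple pads them to four. *)
assert (Eu : forall x y t, 0 <= t < T ->
  d_t T u x y t = - u' * d_x u x y t + - v' * d_y u x y t
    + - (1 / rho') * d_x p x y t + 0 * d_x p x y t).
{ intros a b s Hs; destruct (HE a b s Hs) as [_ [E _]]; lra. }
assert (Ev : forall x y t, 0 <= t < T ->
  d_t T v x y t = - u' * d_x v x y t + - v' * d_y v x y t
    + - (1 / rho') * d_y p x y t + 0 * d_y p x y t).
{ intros a b s Hs; destruct (HE a b s Hs) as [_ [_ [E _]]]; lra. }
destruct (partials_comb 1 T _ _ _ _ _ _ _ _ _ Hpx Hpy Hux Hvy Ep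
  x y t Ht) as [Px [Py Pt]].
destruct (partials_comb 1 T _ _ _ _ _ _ _ _ _ Hux Huy Hpx Hpx Eu
  x y t Ht) as [Ux [Uy Ut]].
destruct (partials_comb 1 T _ _ _ _ _ _ _ _ _ Hvx Hvy Hpy Hpy Ev
  x y t Ht) as [Vx [Vy Vt]].
rewrite <- (d_x_d_t 1 T p), <- (d_y_d_t 1 T p), <- (d_x_d_t 1 T u),
  <- (d_y_d_t 1 T v), Px, Py, Ux, Vy in Pt by assumption.
rewrite <- (d_x_d_t 1 T u), <- (d_y_d_t 1 T u), <- (d_x_d_t 1 T p),
  Ux, Uy, Px in Ut by assumption.
rewrite <- (d_x_d_t 1 T v), <- (d_y_d_t 1 T v), <- (d_y_d_t 1 T p),
  Vx, Vy, Py in Vt by assumption.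
rewrite <- !(d_x_d_y 1 T p), <- !(d_x_d_y 1 T u), <- !(d_x_d_y 1 T v)
  in Pt by assumption.
rewrite <- !(d_x_d_y 1 T p), <- !(d_x_d_y 1 T u), <- ?(d_x_d_y 1 T v)
  in Ut by assumption.
rewrite <- !(d_x_d_y 1 T p), <- ?(d_x_d_y 1 T u), <- !(d_x_d_y 1 T v)
  in Vt by assumption.
rewrite Pt, Ut, Vt; repeat split; ring.
Qed.

(** * Equality up to third order, and expansions in time and space *)

Lemma eq_O3_intro (D : R -> Prop) (f g : R -> R) (C d : R) :
  0 < d ->
  (forall s, 0 < s < d -> D s -> Rabs (f s - g s) <= C * s ^ 3) ->
  eq_O3 D f g.
Proof.
intros Hd H; exists C, (mkposreal d Hd); intros s Hs Hs0 HD.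
change (Rabs (s - 0) < d) in Hs; apply Rabs_lt_between in Hs.
apply H; [lra | exact HD].
Qed.

Lemma eq_O3_ext (D : R -> Prop) (f g : R -> R) :
  (forall s, D s -> f s = g s) -> eq_O3 D f g.
Proof.
intros H; apply (eq_O3_intro D f g 0 1 Rlt_0_1); intros s _ HD.
rewrite H, Rminus_diag, Rabs_R0 by exact HD; lra.
Qed.

Lemma eq_O3_sym (D : R -> Prop) (f g : R -> R) :
  eq_O3 D f g -> eq_O3 D g f.
Proof.
intros [C H]; exists C; revert H; apply filter_imp.
intros s H; now rewrite Rabs_minus_sym.
Qed.

Lemma eq_O3_trans (D : R -> Prop) (f g h : R -> R) :
  eq_O3 D f g -> eq_O3 D g h -> eq_O3 D f h.
Proof.
intros [C H] [C' H']; exists (C + C').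
generalize (filter_and _ _ H H'); apply filter_imp.
intros s [Hs Hs'].
apply Rabs_le_between in Hs; apply Rabs_le_between in Hs'.
apply Rabs_le_between; lra.
Qed.

Lemma eq_O3_plus (D : R -> Prop) (f g f' g' : R -> R) :
  eq_O3 D f g -> eq_O3 D f' g' ->
  eq_O3 D (fun s => f s + f' s) (fun s => g s + g' s).
Proof.
intros [C H] [C' H']; exists (C + C').
generalize (filter_and _ _ H H'); apply filter_imp.
intros s [Hs Hs'].
apply Rabs_le_between in Hs; apply Rabs_le_between in Hs'.
apply Rabs_le_between; lra.
Qed.

Lemma eq_O3_scal (D : R -> Prop) (k : R) (f g : R -> R) :
  eq_O3 D f g -> eq_O3 D (fun s => k * f s) (fun s => k * g s).
Proof.
intros [C H]; exists (Rabs k * C); revert H; apply filter_imp.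
intros s H; rewrite <- Rmult_minus_distr_l, Rabs_mult, Rmult_assoc.
apply Rmult_le_compat_l; [apply Rabs_pos | auto].
Qed.

Lemma time_taylor (D : R -> Prop) (T : R) (f : field) (x y t : R) :
  class_C 3 T f -> 0 <= t < T -> (forall s, D s -> t + s < T) ->
  eq_O3 D (fun s => f x y (t + s))
    (fun s => f x y t + s * d_t T f x y t + s ^ 2 / 2 * d_t T (d_t T f) x y t).
Proof.
intros Hf Ht HD.
destruct (ray_taylor_remainder 3 T f x y t 1 Hf Ht Rlt_0_1)
  as [C [d [_ [Hd H]]]].
apply (eq_O3_intro D _ _ C d Hd); intros s Hs Ds.
specialize (HD s Ds).
assert (Z : Rabs 0 <= 1) by (rewrite Rabs_R0; lra).
specialize (H 0 0 1 s Z Z ltac:(lra) Hs ltac:(lra)).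
simpl ray_taylor in H.
rewrite !Rmult_0_l, !Rplus_0_r, Rmult_1_l in H.
match type of H with Rabs ?u <= _ =>
  match goal with |- Rabs ?v <= _ => replace v with u by field end end.
exact H.
Qed.

Definition space_taylor (f : field) (x y t a b s : R) : R :=
  f x y t + s * (a * d_x f x y t + b * d_y f x y t)
  + s ^ 2 / 2 * (a ^ 2 * d_x (d_x f) x y t + 2 * a * b * d_x (d_y f) x y t
                 + b ^ 2 * d_y (d_y f) x y t).

Lemma space_taylor_remainder (T : R) (f : field) (x y t M : R) :
  class_C 3 T f -> 0 <= t < T -> 0 < M ->
  exists C d, 0 <= C /\ 0 < d /\ forall a b s,
    Rabs a <= M -> Rabs b <= M -> 0 < s < d ->
    Rabs (f (x + a * s) (y + b * s) t - space_taylor f x y t a b s)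
    <= C * s ^ 3.
Proof.
intros Hf Ht HM.
destruct (ray_taylor_remainder 3 T f x y t M Hf Ht HM)
  as [C [d [HC [Hd H]]]].
exists C, d; split; [exact HC|]; split; [exact Hd|].
intros a b s Ha Hb Hs.
specialize (H a b 0 s Ha Hb ltac:(lra) Hs ltac:(lra)).
simpl ray_taylor in H.
rewrite !Rmult_0_l, !Rplus_0_r in H.
rewrite <- (d_x_d_y 1 T f x y t Hf Ht) in H.
match type of H with Rabs ?u <= _ =>
  match goal with |- Rabs ?v <= _ => replace v with u
    by (unfold space_taylor; field) end end.
exact H.
Qed.

(** * Weighted integrals over circles *)

(** One family covers both factors of every integrand: the second-order expansion on a circle and
    the weights of the evolution formulas. *)
Definition trig_quad (k0 k1 k2 k3 k4 k5 th : R) : R :=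
  k0 + k1 * cos th + k2 * sin th
  + k3 * cos th ^ 2 + k4 * (cos th * sin th) + k5 * sin th ^ 2.

(** With [sin^2 = 1 - cos^2], every product of two [trig_quad] takes this form. Over a period only
    the even powers of the cosine without a sine factor survive, with integrals [2 PI], [PI] and
    [3 PI / 4]. *)
Lemma is_RInt_trig (a0 a1 a2 a3 a4 b0 b1 b2 b3 : R) :
  is_RInt (fun th =>
    a0 + a1 * cos th + a2 * cos th ^ 2 + a3 * cos th ^ 3 + a4 * cos th ^ 4
    + sin th * (b0 + b1 * cos th + b2 * cos th ^ 2 + b3 * cos th ^ 3))
    0 (2 * PI) (PI * (2 * a0 + a2 + 3 / 4 * a4)).
Proof.
set (F := fun th =>
  a0 * th + a1 * sin th + a2 * ((th + cos th * sin th) / 2)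
  + a3 * (sin th - sin th ^ 3 / 3)
  + a4 * ((3 * th + 3 * (cos th * sin th) + 2 * (cos th ^ 3 * sin th)) / 8)
  - b0 * cos th - b1 * (cos th ^ 2 / 2) - b2 * (cos th ^ 3 / 3)
  - b3 * (cos th ^ 4 / 4)).
evar_last.
- apply (is_RInt_derive F).
  + intros th _; unfold F; auto_derive; [trivial|].
    assert (H : sin th ^ 2 = 1 - cos th ^ 2)
      by (generalize (sin2_cos2 th); unfold Rsqr; lra).
    field [H].
  + intros th _.
    apply (ex_derive_continuous (V := R_NormedModule)).
    auto_derive; trivial.
- change (F (2 * PI) - F 0 = PI * (2 * a0 + a2 + 3 / 4 * a4)); unfold F.
  rewrite cos_2PI, sin_2PI, cos_0, sin_0; field.
Qed.

Lemma RInt_trig_quad_mult (k0 k1 k2 k3 k4 k5 w0 w1 w2 w3 w4 w5 : R) :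
  is_RInt (fun th =>
    trig_quad k0 k1 k2 k3 k4 k5 th * trig_quad w0 w1 w2 w3 w4 w5 th)
    0 (2 * PI)
    (PI * (2 * k0 * w0 + k0 * (w3 + w5) + (k3 + k5) * w0 + k1 * w1 + k2 * w2
           + 3 / 4 * (k3 * w3 + k5 * w5)
           + 1 / 4 * (k3 * w5 + k5 * w3 + k4 * w4))).
Proof.
evar_last.
(* The coefficients result from writing each factor as [(k0 + k5) + k1 cos + (k3 - k5) cos^2 + sin
   (k2 + k4 cos)] and reducing the product of the two sine parts. *)
- eapply is_RInt_ext; [|apply (is_RInt_trig
    ((k0 + k5) * (w0 + w5) + k2 * w2)
    ((k0 + k5) * w1 + k1 * (w0 + w5) + k2 * w4 + k4 * w2)
    ((k0 + k5) * (w3 - w5) + k1 * w1 + (k3 - k5) * (w0 + w5)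
     + k4 * w4 - k2 * w2)
    (k1 * (w3 - w5) + (k3 - k5) * w1 - k2 * w4 - k4 * w2)
    ((k3 - k5) * (w3 - w5) - k4 * w4)
    ((k0 + k5) * w2 + (w0 + w5) * k2)
    ((k0 + k5) * w4 + (w0 + w5) * k4 + k1 * w2 + w1 * k2)
    ((k3 - k5) * w2 + k1 * w4 + w1 * k4 + (w3 - w5) * k2)
    ((k3 - k5) * w4 + (w3 - w5) * k4))].
  intros th _; unfold trig_quad.
  assert (H : sin th ^ 2 = 1 - cos th ^ 2)
    by (generalize (sin2_cos2 th); unfold Rsqr; lra).
  match goal with |- ?u = ?v => change (@eq R u v) end; ring [H].
- field.
Qed.

Lemma ex_derive_trig_quad (k0 k1 k2 k3 k4 k5 th : R) :
  ex_derive (trig_quad k0 k1 k2 k3 k4 k5) th.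
Proof. unfold trig_quad; auto_derive; trivial. Qed.

Lemma trig_quad_bound (k0 k1 k2 k3 k4 k5 th : R) :
  Rabs (trig_quad k0 k1 k2 k3 k4 k5 th)
  <= Rabs k0 + Rabs k1 + Rabs k2 + Rabs k3 + Rabs k4 + Rabs k5.
Proof.
assert (Hc : Rabs (cos th) <= 1) by (apply Rabs_le, COS_bound).
assert (Hs : Rabs (sin th) <= 1) by (apply Rabs_le, SIN_bound).
assert (K : forall k z, Rabs z <= 1 -> Rabs (k * z) <= Rabs k).
{ intros k z Hz; rewrite Rabs_mult; apply Rle_trans with (Rabs k * 1); [|lra].
  apply Rmult_le_compat_l; [apply Rabs_pos | exact Hz]. }
assert (M : forall z w, Rabs z <= 1 -> Rabs w <= 1 -> Rabs (z * w) <= 1).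
{ intros z w Hz Hw; apply Rle_trans with (2 := Hz), K, Hw. }
unfold trig_quad; simpl pow; rewrite !Rmult_1_r.
do 5 (apply Rle_trans with (1 := Rabs_triang _ _); apply Rplus_le_compat;
  [|now apply K; auto]).
apply Rle_refl.
Qed.

Lemma ex_RInt_circle (k : nat) (T : R) (f : field)
    (x y t al be r s w0 w1 w2 w3 w4 w5 : R) :
  class_C k T f -> 0 <= t < T ->
  ex_RInt (fun th =>
    f (x + (al + r * cos th) * s) (y + (be + r * sin th) * s) t
    * trig_quad w0 w1 w2 w3 w4 w5 th) 0 (2 * PI).
Proof.
intros Hf Ht; apply (ex_RInt_continuous (V := R_CompleteNormedModule)).
intros th _.
apply (continuous_mult (K := R_AbsRing)).
- apply (continuous_comp_2 (fun th => x + (al + r * cos th) * s)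
    (fun th => y + (be + r * sin th) * s) (fun a b => f a b t)).
  + apply (ex_derive_continuous (V := R_NormedModule)); auto_derive; trivial.
  + apply (ex_derive_continuous (V := R_NormedModule)); auto_derive; trivial.
  + apply (proj1 (continuity_2d_pt_filterlim (fun a b => f a b t) _ _)).
    exact (class_C_continuity_xy k T f _ _ t Hf Ht).
- apply (ex_derive_continuous (V := R_NormedModule)), ex_derive_trig_quad.
Qed.

Lemma space_taylor_circle (f : field) (x y t al be r s th : R) :
  space_taylor f x y t (al + r * cos th) (be + r * sin th) s =
  trig_quad (space_taylor f x y t al be s)
    (r * s * (d_x f x y t
              + s * (al * d_x (d_x f) x y t + be * d_x (d_y f) x y t)))
    (r * s * (d_y f x y t
              + s * (al * d_x (d_y f) x y t + be * d_y (d_y f) x y t)))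
    (r ^ 2 * s ^ 2 / 2 * d_x (d_x f) x y t)
    (r ^ 2 * s ^ 2 * d_x (d_y f) x y t)
    (r ^ 2 * s ^ 2 / 2 * d_y (d_y f) x y t) th.
Proof. unfold space_taylor, trig_quad; field. Qed.

(** Here [al], [be], [r] are velocities: the centre drifts with [s] and the radius is [r * s].
    Replacing [f] by its expansion turns the integrand into a product of two [trig_quad], integrated
    exactly. *)
Lemma circle_moment (D : R -> Prop) (T : R) (f : field)
    (x y t al be r w0 w1 w2 w3 w4 w5 : R) :
  class_C 3 T f -> 0 <= t < T ->
  eq_O3 D
    (fun s => RInt (fun th =>
       f (x + (al + r * cos th) * s) (y + (be + r * sin th) * s) t
       * trig_quad w0 w1 w2 w3 w4 w5 th) 0 (2 * PI))
    (fun s => PI *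
       ((2 * w0 + w3 + w5) * space_taylor f x y t al be s
        + r * s * (w1 * (d_x f x y t
            + s * (al * d_x (d_x f) x y t + be * d_x (d_y f) x y t))
          + w2 * (d_y f x y t
            + s * (al * d_x (d_y f) x y t + be * d_y (d_y f) x y t)))
        + r ^ 2 * s ^ 2 / 2 *
          ((w0 + 3 / 4 * w3 + 1 / 4 * w5) * d_x (d_x f) x y t
           + 1 / 2 * w4 * d_x (d_y f) x y t
           + (w0 + 1 / 4 * w3 + 3 / 4 * w5) * d_y (d_y f) x y t))).
Proof.
intros Hf Ht.
(* [M] bounds both components of all directions to the circle; the added 1 makes it positive. *)
set (M := Rabs al + Rabs be + Rabs r + 1).
assert (P1 := Rabs_pos al); assert (P2 := Rabs_pos be).
assert (P3 := Rabs_pos r).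
destruct (space_taylor_remainder T f x y t M Hf Ht ltac:(unfold M; lra))
  as [C [d [HC [Hd H]]]].
set (W := Rabs w0 + Rabs w1 + Rabs w2 + Rabs w3 + Rabs w4 + Rabs w5).
(* Length of the interval, times the uniform Taylor constant, times a bound of the weight. *)
apply (eq_O3_intro D _ _ (2 * PI * (C * W)) d Hd); intros s Hs _.
assert (Hq : is_RInt (fun th =>
  space_taylor f x y t (al + r * cos th) (be + r * sin th) s
  * trig_quad w0 w1 w2 w3 w4 w5 th) 0 (2 * PI)
  (PI * ((2 * w0 + w3 + w5) * space_taylor f x y t al be s
        + r * s * (w1 * (d_x f x y t
            + s * (al * d_x (d_x f) x y t + be * d_x (d_y f) x y t))
          + w2 * (d_y f x y t
            + s * (al * d_x (d_y f) x y t + be * d_y (d_y f) x y t)))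
        + r ^ 2 * s ^ 2 / 2 *
          ((w0 + 3 / 4 * w3 + 1 / 4 * w5) * d_x (d_x f) x y t
           + 1 / 2 * w4 * d_x (d_y f) x y t
           + (w0 + 1 / 4 * w3 + 3 / 4 * w5) * d_y (d_y f) x y t)))).
{ evar_last.
  - eapply is_RInt_ext; [|apply RInt_trig_quad_mult].
    intros th _; cbv beta; rewrite space_taylor_circle; reflexivity.
  - generalize (space_taylor f x y t al be s); intros z; field. }
assert (Hi := RInt_correct _ _ _
  (ex_RInt_circle 3 T f x y t al be r s w0 w1 w2 w3 w4 w5 Hf Ht)).
assert (Hm := is_RInt_minus _ _ _ _ _ _ Hi Hq).
replace (2 * PI * (C * W) * s ^ 3)
  with ((2 * PI - 0) * (C * s ^ 3 * W)) by ring.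
assert (HPI := PI_RGT_0).
apply (norm_RInt_le_const (V := R_NormedModule)) with (3 := Hm); [lra|].
intros th _.
match goal with |- norm (minus (?u * ?w) (?v * ?w)) <= _ =>
  change (Rabs (u * w - v * w) <= C * s ^ 3 * W);
  replace (u * w - v * w) with ((u - v) * w) by ring end.
rewrite Rabs_mult; apply Rmult_le_compat; try apply Rabs_pos.
- assert (K : forall z e, Rabs e <= 1 -> Rabs z <= M - Rabs r - 1 ->
    Rabs (z + r * e) <= M).
  { intros z e He Hz; apply Rle_trans with (1 := Rabs_triang _ _).
    rewrite Rabs_mult.
    assert (Rabs r * Rabs e <= Rabs r * 1)
      by (apply Rmult_le_compat_l; assumption).
    lra. }
  apply H; [| |exact Hs]; apply K; try (unfold M; lra);
    apply Rabs_le; [apply COS_bound | apply SIN_bound].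
- apply trig_quad_bound.
Qed.

Lemma eq_O3_center (D : R -> Prop) (T : R) (f : field) (x y t al be : R) :
  class_C 3 T f -> 0 <= t < T ->
  eq_O3 D (fun s => f (x + al * s) (y + be * s) t)
    (fun s => space_taylor f x y t al be s).
Proof.
intros Hf Ht.
assert (P1 := Rabs_pos al); assert (P2 := Rabs_pos be).
destruct (space_taylor_remainder T f x y t (Rabs al + Rabs be + 1) Hf Ht
  ltac:(lra)) as [C [d [_ [Hd H]]]].
apply (eq_O3_intro D _ _ C d Hd); intros s Hs _; apply H; lra.
Qed.

(* The weights 4/3 and -1/3 in [hat] cancel the quadratic terms of the circle
   means, so [hat] agrees with the value at the centre. *)
Lemma eq_O3_hat (D : R -> Prop) (T : R) (f : field) (x y t al be r : R) :
  class_C 3 T f -> 0 <= t < T ->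
  eq_O3 D
    (fun s => hat (fun a b => f a b t) (r * s) (x + al * s) (y + be * s))
    (fun s => space_taylor f x y t al be s).
Proof.
intros Hf Ht.
assert (HPI := PI_RGT_0).
assert (H := fun r => circle_moment D T f x y t al be r 1 0 0 0 0 0 Hf Ht).
assert (H1 := eq_O3_scal D (1 / 3 * (4 / (2 * PI))) _ _ (H (r / 2))).
assert (H2 := eq_O3_scal D (1 / 3 * (- (1 / (2 * PI)))) _ _ (H r)).
refine (eq_O3_trans D _ _ _ _
  (eq_O3_trans D _ _ _ (eq_O3_plus D _ _ _ _ H1 H2) _)).
- apply eq_O3_ext; intros s _; unfold hat.
  rewrite Rmult_minus_distr_l; unfold Rminus; f_equal.
  + rewrite <- Rmult_assoc; f_equal.
    apply RInt_ext; intros th _; unfold trig_quad.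
    match goal with |- ?u = ?v * ?w => replace w with 1 by ring;
      rewrite Rmult_1_r end.
    f_equal; field.
  + rewrite <- Ropp_mult_distr_r_reverse, Ropp_mult_distr_l, <- Rmult_assoc.
    f_equal.
    apply RInt_ext; intros th _; unfold trig_quad.
    match goal with |- ?u = ?v * ?w => replace w with 1 by ring;
      rewrite Rmult_1_r end.
    f_equal; field.
- apply eq_O3_ext; intros s _.
  generalize (space_taylor f x y t al be s); intros z; field; lra.
Qed.

(** * Sound speed and exact transport for the density *)

Lemma sound_speed_pow2 (gamma rho' p' : R) :
  0 < rho' -> 0 < p' -> 1 < gamma ->
  0 < sound_speed gamma rho' p' /\
  gamma * p' = rho' * sound_speed gamma rho' p' ^ 2.
Proof.
intros Hr Hp Hg; unfold sound_speed.
assert (H : 0 < gamma * p' / rho')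
  by (apply Rdiv_lt_0_compat; [apply Rmult_lt_0_compat; lra | exact Hr]).
split; [apply sqrt_lt_R0, H|].
rewrite pow2_sqrt by lra; field; lra.
Qed.

(* [rho - p / c'^2] is transported by the background flow. *)
Lemma entropy_transport (gamma rho' u' v' p' T : R) (rho u v p : field)
    (x y t tau : R) :
  0 < rho' -> 0 < p' -> 1 < gamma ->
  class_C 1 T rho -> class_C 1 T p ->
  linearized_euler gamma rho' u' v' p' T rho u v p ->
  0 <= t < T -> 0 < tau -> t + tau < T ->
  rho x y (t + tau) - 1 / sound_speed gamma rho' p' ^ 2 * p x y (t + tau) =
  rho (x - u' * tau) (y - v' * tau) t
  - 1 / sound_speed gamma rho' p' ^ 2 * p (x - u' * tau) (y - v' * tau) t.
Proof.
intros Hr Hp' Hg Hrho Hp HE Ht Htau HT.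
destruct (sound_speed_pow2 gamma rho' p' Hr Hp' Hg) as [Hc HK].
set (c := sound_speed gamma rho' p') in *.
set (x0 := x - u' * tau); set (y0 := y - v' * tau).
(* The particle path starts at [P'] for [s = 0] and reaches [P] for [s = tau]. *)
set (F := fun (f : field) s => f (x0 + u' * s) (y0 + v' * s) (t + 1 * s)).
set (G := fun (f : field) s =>
  u' * F (d_x f) s + v' * F (d_y f) s + 1 * F (d_t T f) s).
set (h := fun s => F rho s - 1 / c ^ 2 * F p s).
assert (Htau' : F rho tau = rho x y (t + tau) /\ F p tau = p x y (t + tau)).
{ unfold F, x0, y0; split; f_equal; ring. }
assert (H0 : F rho 0 = rho x0 y0 t /\ F p 0 = p x0 y0 t).
{ unfold F; split; f_equal; ring. }
(* The mean value bound with constant 0 expresses that [h] is constant along the path. *)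
assert (Hh : Rabs (h tau - h 0) <= 0 * tau ^ 1).
{ apply (mean_value_bound h (fun s => G rho s - 1 / c ^ 2 * G p s) 0 0 tau).
  - exact Htau.
  - apply Rle_refl.
  - intros s Hs.
    assert (D1 : is_derive (F rho) s (G rho s))
      by (apply (is_derive_ray 0 T rho); trivial; lra).
    assert (D2 : is_derive (F p) s (G p s))
      by (apply (is_derive_ray 0 T p); trivial; lra).
    apply (is_derive_minus (F rho) (fun s => 1 / c ^ 2 * F p s)); [exact D1|].
    exact (is_derive_scal (F p) s (1 / c ^ 2) (G p s) D2).
  - intros eps Heps.
    assert (Hk : 0 < 1 / c ^ 2)
      by (apply Rdiv_lt_0_compat; [lra | apply pow_lt, Hc]).
    assert (He : 0 < eps / 2 / (1 / c ^ 2))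
      by (apply Rdiv_lt_0_compat; lra).
    destruct (ray_right_continuous 1 T rho x0 y0 t u' v' 1 Hrho Ht Rle_0_1
      (eps / 2) ltac:(lra)) as [d1 [Hd1 H1]].
    destruct (ray_right_continuous 1 T p x0 y0 t u' v' 1 Hp Ht Rle_0_1
      _ He) as [d2 [Hd2 H2]].
    exists (Rmin tau (Rmin d1 d2)).
    split; [repeat apply Rmin_glb_lt; assumption|]; intros s Hs.
    assert (M1 := Rmin_l tau (Rmin d1 d2)).
    assert (M2 := Rmin_r tau (Rmin d1 d2)).
    assert (M3 := Rmin_l d1 d2); assert (M4 := Rmin_r d1 d2).
    specialize (H1 s ltac:(lra) ltac:(lra)).
    specialize (H2 s ltac:(lra) ltac:(lra)).
    fold (F rho s) in H1; fold (F p s) in H2.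
    apply (Rlt_div_r _ _ _ Hk) in H2.
    unfold h; rewrite (proj1 H0), (proj2 H0).
    rewrite <- (Rabs_pos_eq (1 / c ^ 2)) in H2 by lra.
    rewrite <- Rabs_mult in H2.
    apply Rabs_lt_between in H1; apply Rabs_lt_between in H2.
    apply Rabs_lt_between; lra.
  - intros s Hs.
    destruct (HE (x0 + u' * s) (y0 + v' * s) (t + 1 * s) ltac:(lra))
      as [E1 [_ [_ E4]]].
    (* With [gamma * p' = rho' * c ^ 2], the divergence terms of the density equation and of the
       pressure equation divided by [c ^ 2] cancel. *)
    rewrite HK in E4.
    replace (G rho s - 1 / c ^ 2 * G p s) with 0.
    + rewrite Rabs_R0; lra.
    + unfold G, F.
      match type of E1 with ?a + ?b + ?b' + ?e = 0 =>
        match type of E4 with ?a' + ?d + ?d' + ?e' = 0 =>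
          replace (1 / c ^ 2 * _) with (1 / c ^ 2 * (- e'));
          [replace (u' * _ + v' * _ + 1 * _) with (- e) by lra; field; lra
          | f_equal; lra] end end. }
unfold h in Hh; rewrite (proj1 Htau'), (proj2 Htau'), (proj1 H0), (proj2 H0) in Hh.
apply Rabs_le_between in Hh; lra.
Qed.

(** The integrands mix three fields on one circle; splitting them by field lets [circle_moment]
    apply to each. *)
Lemma RInt_circle_plus3 (k : nat) (T : R) (f1 f2 f3 : field) (g : R -> R)
    (x y t al be r s a0 a1 a2 a3 a4 a5 b0 b1 b2 b3 b4 b5
     c0 c1 c2 c3 c4 c5 : R) :
  class_C k T f1 -> class_C k T f2 -> class_C k T f3 -> 0 <= t < T ->
  let on_circle := fun (f : field) th =>
    f (x + (al + r * cos th) * s) (y + (be + r * sin th) * s) t in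
  (forall th, g th =
     on_circle f1 th * trig_quad a0 a1 a2 a3 a4 a5 th
     + on_circle f2 th * trig_quad b0 b1 b2 b3 b4 b5 th
     + on_circle f3 th * trig_quad c0 c1 c2 c3 c4 c5 th) ->
  RInt g 0 (2 * PI) =
    RInt (fun th => on_circle f1 th * trig_quad a0 a1 a2 a3 a4 a5 th) 0 (2 * PI)
    + RInt (fun th => on_circle f2 th * trig_quad b0 b1 b2 b3 b4 b5 th)
        0 (2 * PI)
    + RInt (fun th => on_circle f3 th * trig_quad c0 c1 c2 c3 c4 c5 th)
        0 (2 * PI).
Proof.
intros H1 H2 H3 Ht on_circle Hg.
assert (I1 := RInt_correct _ _ _
  (ex_RInt_circle k T f1 x y t al be r s a0 a1 a2 a3 a4 a5 H1 Ht)).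
assert (I2 := RInt_correct _ _ _
  (ex_RInt_circle k T f2 x y t al be r s b0 b1 b2 b3 b4 b5 H2 Ht)).
assert (I3 := RInt_correct _ _ _
  (ex_RInt_circle k T f3 x y t al be r s c0 c1 c2 c3 c4 c5 H3 Ht)).
apply is_RInt_unique.
eapply is_RInt_ext;
  [|exact (is_RInt_plus _ _ _ _ _ _ (is_RInt_plus _ _ _ _ _ _ I1 I2) I3)].
intros th _; symmetry; apply Hg.
Qed.

Theorem mainTheorem3
    (gamma rho' u' v' p' : R) (Dt CFL omega delta nu T : R)
    (rho u v p : field) (x y t : R) :
  0 < rho' -> 0 < p' -> 1 < gamma ->
  0 < Dt -> 0 < CFL ->
  0 <= omega <= 1 ->
  0 <= delta -> 0 <= nu ->
  delta * CFL <= 1 / 2 -> nu * CFL <= 1 / 2 ->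
  class_C 3 T rho -> class_C 3 T u -> class_C 3 T v -> class_C 3 T p ->
  linearized_euler gamma rho' u' v' p' T rho u v p ->
  0 <= t < T ->
  let c' := sound_speed gamma rho' p' in
  let admissible := fun tau => 0 < tau <= Dt /\ t + tau < T in
  let atP := fun (f : field) tau => f x y (t + tau) in
  let atP' := fun (f : field) tau => f (x - u' * tau) (y - v' * tau) t in
  let atQ := fun (f : field) tau theta =>
    f (x - (u' - c' * cos theta) * tau) (y - (v' - c' * sin theta) * tau) t in
  let hatP' := fun (f : field) r tau =>
    hat (fun a b => f a b t) r (x - u' * tau) (y - v' * tau) in
  eq_O3 admissible (atP p)
    (fun tau =>
       - hatP' p (delta * c' * tau) tau
       + 1 / PI *
         RInt (fun theta =>
           atQ p tau theta
           - rho' * c' * atQ u tau theta * cos theta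
           - rho' * c' * atQ v tau theta * sin theta) 0 (2 * PI)) /\
  (forall tau, admissible tau ->
     atP rho tau = atP' rho tau + 1 / c' ^ 2 * (atP p tau - atP' p tau)) /\
  eq_O3 admissible (atP u)
    (fun tau =>
       1 / PI *
         RInt (fun theta =>
           - (atQ p tau theta / (rho' * c')) * cos theta
           + atQ u tau theta * (2 * cos theta ^ 2 - 1 / 2)
           + 2 * atQ v tau theta * sin theta * cos theta) 0 (2 * PI)
       - omega * (atP' u tau - hatP' u (nu * c' * tau) tau)) /\
  eq_O3 admissible (atP v)
    (fun tau =>
       1 / PI *
         RInt (fun theta =>
           - (atQ p tau theta / (rho' * c')) * sin theta
           + atQ v tau theta * (2 * sin theta ^ 2 - 1 / 2)
           + 2 * atQ u tau theta * sin theta * cos theta) 0 (2 * PI)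
       - omega * (atP' v tau - hatP' v (nu * c' * tau) tau)).
Proof.
intros Hr Hp' Hg _ _ _ _ _ _ _ Crho Cu Cv Cp HE Ht c' adm atP atP' atQ hatP'.
destruct (sound_speed_pow2 gamma rho' p' Hr Hp' Hg) as [Hc HK].
fold c' in Hc, HK.
assert (HPI := PI_RGT_0).
assert (Hadm : forall s, adm s -> t + s < T) by (intros s Hs; apply Hs).
assert (Tp := time_taylor adm T p x y t Cp Ht Hadm).
assert (Tu := time_taylor adm T u x y t Cu Ht Hadm).
assert (Tv := time_taylor adm T v x y t Cv Ht Hadm).
destruct (euler_d_t_d_t gamma rho' u' v' p' T rho u v p x y t Cu Cv Cp HE Ht)
  as [Dp [Du Dv]].
rewrite HK in Dp, Du, Dv.
destruct (HE x y t Ht) as [_ [Eu [Ev Ep]]].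
rewrite HK in Ep.
(* [Q] runs over the circle with drift [(- u', - v')] and radius speed [c']. *)
assert (AtQ : forall f tau th, atQ f tau th =
  f (x + (- u' + c' * cos th) * tau) (y + (- v' + c' * sin th) * tau) t).
{ intros f tau th; unfold atQ; f_equal; ring. }
assert (AtP' : forall f tau, atP' f tau =
  f (x + - u' * tau) (y + - v' * tau) t).
{ intros f tau; unfold atP'; f_equal; ring. }
assert (Hat : forall f k, class_C 3 T f ->
  eq_O3 adm (fun tau => hatP' f (k * c' * tau) tau)
    (fun tau => space_taylor f x y t (- u') (- v') tau)).
{ intros f k Cf.
  refine (eq_O3_trans _ _ _ _ _
    (eq_O3_hat adm T f x y t (- u') (- v') (k * c') Cf Ht)).
  apply eq_O3_ext; intros tau _; unfold hatP'; f_equal; ring. }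
assert (Center : forall f, class_C 3 T f ->
  eq_O3 adm (fun tau => atP' f tau)
    (fun tau => space_taylor f x y t (- u') (- v') tau)).
{ intros f Cf.
  refine (eq_O3_trans _ _ _ _ _
    (eq_O3_center adm T f x y t (- u') (- v') Cf Ht)).
  apply eq_O3_ext; intros tau _; apply AtP'. }
assert (Circle := fun f w0 w1 w2 w3 w4 w5 Cf => eq_O3_scal adm (1 / PI) _ _
  (circle_moment adm T f x y t (- u') (- v') c' w0 w1 w2 w3 w4 w5 Cf Ht)).
split; [|split; [|split]].
- assert (S := eq_O3_plus _ _ _ _ _
    (eq_O3_plus _ _ _ _ _
      (eq_O3_plus _ _ _ _ _ (eq_O3_scal adm (-1) _ _ (Hat p delta Cp))
        (Circle p 1 0 0 0 0 0 Cp))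
      (Circle u 0 (- (rho' * c')) 0 0 0 0 Cu))
    (Circle v 0 0 (- (rho' * c')) 0 0 0 Cv)).
  (* Two exact identities remain: the formula is the sum of the circle moments, and the resulting
     polynomial in [tau] is the time expansion. *)
  refine (eq_O3_trans _ _ _ _ Tp (eq_O3_sym _ _ _
    (eq_O3_trans _ _ _ _ (eq_O3_trans _ _ _ _ _ S) _)));
    apply eq_O3_ext; intros tau _.
  + rewrite (RInt_circle_plus3 3 T p u v _ x y t (- u') (- v') c' tau
      1 0 0 0 0 0 0 (- (rho' * c')) 0 0 0 0 0 0 (- (rho' * c')) 0 0 0
      Cp Cu Cv Ht); [ring|].
    intros th; rewrite !AtQ; unfold trig_quad; ring.
  + unfold space_taylor; rewrite Dp.
    replace (d_t T p x y t) with
      (- u' * d_x p x y t - v' * d_y p x y t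
       - rho' * c' ^ 2 * (d_x u x y t + d_y v x y t)) by lra.
    field; lra.
- intros tau [Htau HT]; unfold atP, atP'.
  assert (E := entropy_transport gamma rho' u' v' p' T rho u v p x y t tau
    Hr Hp' Hg (class_C_pred _ _ _ (class_C_pred _ _ _ Crho))
    (class_C_pred _ _ _ (class_C_pred _ _ _ Cp)) HE Ht (proj1 Htau) HT).
  fold c' in E; lra.
- assert (S := eq_O3_plus _ _ _ _ _
    (eq_O3_plus _ _ _ _ _
      (eq_O3_plus _ _ _ _ _ (Circle p 0 (- (1 / (rho' * c'))) 0 0 0 0 Cp)
        (Circle u (- (1 / 2)) 0 0 2 0 0 Cu))
      (Circle v 0 0 0 0 2 0 Cv))
    (* The centre value and [hat] have the same expansion, so this term is of third order for every
       [omega]. *)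
    (eq_O3_scal _ (- omega) _ _ (eq_O3_plus _ _ _ _ _ (Center u Cu)
      (eq_O3_scal _ (-1) _ _ (Hat u nu Cu))))).
  refine (eq_O3_trans _ _ _ _ Tu (eq_O3_sym _ _ _
    (eq_O3_trans _ _ _ _ (eq_O3_trans _ _ _ _ _ S) _)));
    apply eq_O3_ext; intros tau _.
  + rewrite (RInt_circle_plus3 3 T p u v _ x y t (- u') (- v') c' tau
      0 (- (1 / (rho' * c'))) 0 0 0 0 (- (1 / 2)) 0 0 2 0 0 0 0 0 0 2 0
      Cp Cu Cv Ht); [ring|].
    intros th; rewrite !AtQ; unfold trig_quad; field; lra.
  + unfold space_taylor; rewrite Du.
    replace (d_t T u x y t) with
      (- u' * d_x u x y t - v' * d_y u x y t - 1 / rho' * d_x p x y t) by lra.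
    field; lra.
(* The roles of [u] and [v], and of cosine and sine, are exchanged. *)
- assert (S := eq_O3_plus _ _ _ _ _
    (eq_O3_plus _ _ _ _ _
      (eq_O3_plus _ _ _ _ _ (Circle p 0 0 (- (1 / (rho' * c'))) 0 0 0 Cp)
        (Circle v (- (1 / 2)) 0 0 0 0 2 Cv))
      (Circle u 0 0 0 0 2 0 Cu))
    (eq_O3_scal _ (- omega) _ _ (eq_O3_plus _ _ _ _ _ (Center v Cv)
      (eq_O3_scal _ (-1) _ _ (Hat v nu Cv))))).
  refine (eq_O3_trans _ _ _ _ Tv (eq_O3_sym _ _ _
    (eq_O3_trans _ _ _ _ (eq_O3_trans _ _ _ _ _ S) _)));
    apply eq_O3_ext; intros tau _.
  + rewrite (RInt_circle_plus3 3 T p v u _ x y t (- u') (- v') c' tau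
      0 0 (- (1 / (rho' * c'))) 0 0 0 (- (1 / 2)) 0 0 0 0 2 0 0 0 0 2 0
      Cp Cv Cu Ht); [ring|].
    intros th; rewrite !AtQ; unfold trig_quad; field; lra.
  + unfold space_taylor; rewrite Dv.
    replace (d_t T v x y t) with
      (- u' * d_x v x y t - v' * d_y v x y t - 1 / rho' * d_y p x y t) by lra.
    field; lra.
Qed.
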